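(* Let $\Phi:[0,\ell(I)[\,\to\mathbb{R}_+$ be a subadditive and nondecreasing error function and let $f:I\to\mathbb{R}$. Then the following assertions are equivalent. (i) $f$ is $\Phi$-monotone. (ii) There exists a function $H:I\times I\to\mathbb{R}$ such that $H$ satisfies $$\min(H(x,y),H(y,z))=H(x,z)\quad\text{and}\quad \max(H(z,y),H(y,x))=H(z,x)$$ for all $x,y,z\in I$ with $x\le y\le z$ and, for all $p\in I$, the function $h:=H(\cdot,p)$ is nondecreasing and $h_p$ and $h^p$ are $\Phi$-monotone interpolations of $f$ at $p$ from below and from above, respectively. (iii) For every $p\in I$, there exists a nondecreasing function $h:I\to\mathbb{R}$ such that $h_p$ is a $\Phi$-monotone interpolation of $f$ at $p$ from below. (iv) For every $p\in I$, there exists a nondecreasing function $h:I\to\mathbb{R}$ such that $h^p$ is a $\Phi$-monotone interpolation of $f$ at $p$ from above.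
   Context: $I$ is a nonempty open real interval and $\ell(I)\in\,]0,\infty]$ is its length; $\mathbb{R}_+=[0,\infty[$. An error function is any function $\Phi:[0,\ell(I)[\,\to\mathbb{R}_+$. It is subadditive if $\Phi(u+v)\le\Phi(u)+\Phi(v)$ for all $u,v\in\mathbb{R}_+$ with $u+v<\ell(I)$. A function $g:I\to\mathbb{R}$ is $\Phi$-monotone if $g(x)\le g(y)+\Phi(y-x)$ for all $x,y\in I$ with $x\le y$. For $h:I\to\mathbb{R}$ and $p\in I$, the functions $h_p,h^p:I\to\mathbb{R}$ are defined by $h_p(x)=h(x)$ if $x\le p$ and $h_p(x)=h(p)-\Phi(x-p)$ if $p<x$; $h^p(x)=h(p)+\Phi(p-x)$ if $x<p$ and $h^p(x)=h(x)$ if $p\le x$. A function $g:I\to\mathbb{R}$ is a $\Phi$-monotone interpolation of $f$ at $p$ from below [resp. from above] if $g$ is $\Phi$-monotone, $g(p)=f(p)$ and $g\le f$ [resp. $f\le g$] on $I$. *)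

(* Defs.v *)
From mathcomp Require Import all_boot all_order all_algebra.
From mathcomp Require Import all_classical all_reals all_analysis.
Import Order.TTheory GRing.Theory Num.Theory.
Import numFieldNormedType.Exports.

Set Implicit Arguments.
Unset Strict Implicit.
Unset Printing Implicit Defensive.

Local Open Scope classical_set_scope.
Local Open Scope ring_scope.

(* Functions on [I], on [I * I] and on [0, l(I)[ are represented by total
   functions on [R]; every condition below constrains (and only depends on)
   their values on the intended domain. *)

Definition open_interval (R : realType) (I : set R) : Prop :=
  [/\ I !=set0, open I & is_interval I].

Definition ilength (R : realType) (I : set R) : \bar R :=
  (ereal_sup (EFin @` I) - ereal_inf (EFin @` I))%E.

Definition error_dom (R : realType) (I : set R) : set R :=
  [set u | 0 <= u /\ (u%:E < ilength I)%E].

Definition error_function (R : realType) (I : set R) (Phi : R -> R) : Prop :=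
  forall u, error_dom I u -> 0 <= Phi u.

Definition subadditive_error (R : realType) (I : set R) (Phi : R -> R) : Prop :=
  forall u v, 0 <= u -> 0 <= v -> ((u + v)%:E < ilength I)%E ->
    Phi (u + v) <= Phi u + Phi v.

Definition nondecreasing_on (R : realType) (D : set R) (g : R -> R) : Prop :=
  {in D &, {homo g : x y / x <= y}}.

Definition Phi_monotone (R : realType) (I : set R) (Phi g : R -> R) : Prop :=
  forall x y, I x -> I y -> x <= y -> g x <= g y + Phi (y - x).

(* [h_p] *)
Definition lower_ext (R : realType) (Phi h : R -> R) (p : R) : R -> R :=
  fun x => if x <= p then h x else h p - Phi (x - p).

(* [h^p] *)
Definition upper_ext (R : realType) (Phi h : R -> R) (p : R) : R -> R :=
  fun x => if x < p then h p + Phi (p - x) else h x.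

Definition interpolation_below (R : realType) (I : set R) (Phi f : R -> R)
    (p : R) (g : R -> R) : Prop :=
  [/\ Phi_monotone I Phi g, g p = f p & forall x, I x -> g x <= f x].

Definition interpolation_above (R : realType) (I : set R) (Phi f : R -> R)
    (p : R) (g : R -> R) : Prop :=
  [/\ Phi_monotone I Phi g, g p = f p & forall x, I x -> f x <= g x].

(* Main.v *)
Require Import Defs.
From mathcomp Require Import all_boot all_order all_algebra.
From mathcomp Require Import all_classical all_reals all_analysis.
From mathcomp Require Import lra.
Import Order.TTheory GRing.Theory Num.Theory.
Import numFieldNormedType.Exports.

Set Implicit Arguments.
Unset Strict Implicit.
Unset Printing Implicit Defensive.

Local Open Scope classical_set_scope.
Local Open Scope ring_scope.

(** If [f] is [Phi]-monotone, take [H x p] to be the infimum of [f] over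
    [[x, p]] when [x <= p] and the supremum of [f] over [[p, x]] otherwise: the
    min/max identities say that an infimum (supremum) over a union is the
    minimum (maximum) of the two, and [H x p <= f p] for [x <= p] while
    [f p <= H x p] for [p <= x].
    Conversely, the half of an interpolation at [p] where [h] has been replaced
    by [f p -+ Phi] is exactly [Phi]-monotonicity of [f] on the pairs having [p]
    as an endpoint. *)

(** * Infima and suprema over adjacent closed intervals *)

Lemma inf_setU_min (R : realType) (A B : set R) :
  has_inf A -> has_inf B -> inf (A `|` B) = Num.min (inf A) (inf B).
Proof.
move=> [[a Aa] Alb] [[b Bb] Blb].
have lbAB : lbound (A `|` B) (Num.min (inf A) (inf B)).
  by move=> t [/(ge_inf Alb)|/(ge_inf Blb)]; rewrite ge_min => ->; rewrite ?orbT.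
apply/le_anti/andP; split; last by apply: lb_le_inf => //; exists a; left.
have hAB : has_lbound (A `|` B) by exists (Num.min (inf A) (inf B)).
rewrite le_min; apply/andP; split; apply: lb_le_inf.
- by exists a.
- by move=> t At; apply: (ge_inf hAB); left.
- by exists b.
- by move=> t Bt; apply: (ge_inf hAB); right.
Qed.

Lemma sup_setU_max (R : realType) (A B : set R) :
  has_sup A -> has_sup B -> sup (A `|` B) = Num.max (sup A) (sup B).
Proof.
move=> [[a Aa] Aub] [[b Bb] Bub].
have ubAB : ubound (A `|` B) (Num.max (sup A) (sup B)).
  by move=> t [/(ub_le_sup Aub)|/(ub_le_sup Bub)]; rewrite le_max => ->; rewrite ?orbT.
apply/le_anti/andP; split; first by apply: ge_sup => //; exists a; left.
have hAB : has_ubound (A `|` B) by exists (Num.max (sup A) (sup B)).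
rewrite ge_max; apply/andP; split; apply: ge_sup.
- by exists a.
- by move=> t At; apply: (ub_le_sup hAB); left.
- by exists b.
- by move=> t Bt; apply: (ub_le_sup hAB); right.
Qed.

Lemma itvcc_setU (R : realType) (x y z : R) : x <= y -> y <= z ->
  `[x, z]%classic = `[x, y] `|` `[y, z].
Proof.
move=> xy yz; apply/seteqP; split=> t /=; rewrite !in_itv /=.
  by move=> /andP[xt tz]; case: (leP t y) => ty; [left|right];
    rewrite ?xt ?tz // (ltW ty).
case=> /andP[ta tb]; rewrite ?ta ?tb ?andbT //=.
  exact: le_trans tb yz.
exact: le_trans xy ta.
Qed.

(** * Differences of points of [I] as arguments of [Phi] *)

Lemma open_exists_gt (R : realType) (I : set R) (x : R) :
  open I -> I x -> exists2 y, I y & x < y.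
Proof.
move=> oI Ix.
have /nbhs_ballP[e /= e0 xeI] : nbhs x I by apply: open_nbhs_nbhs.
exists (x + e / 2); last by rewrite ltrDl divr_gt0.
apply: xeI; rewrite /ball /= opprD addNKr normrN gtr0_norm ?divr_gt0 //.
by rewrite ltr_pdivrMr // ltr_pMr // ltr1n.
Qed.

(** Openness makes the inequality strict: some [z] in [I] lies beyond [y], so [y - x < z - x], and
    [z - x] is at most the supremum minus the infimum of [I]. *)
Lemma ltB_ilength (R : realType) (I : set R) (x y : R) :
  open I -> I x -> I y -> ((y - x)%:E < ilength I)%E.
Proof.
move=> oI Ix Iy; have [z Iz yz] := open_exists_gt oI Iy.
apply: (@lt_le_trans _ _ (z - x)%:E); first by rewrite lte_fin ltrD2r.
by rewrite EFinB; apply: leeB; [apply: ereal_sup_ubound|apply: ereal_inf_lbound];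
  [exists z|exists x].
Qed.

Lemma error_domB (R : realType) (I : set R) (x y : R) :
  open I -> I x -> I y -> x <= y -> error_dom I (y - x).
Proof. by move=> oI Ix Iy xy; split; [rewrite subr_ge0|exact: ltB_ilength]. Qed.

Lemma subadditive_errorB (R : realType) (I : set R) (Phi : R -> R) (x y z : R) :
  open I -> subadditive_error I Phi -> I x -> I z -> x <= y -> y <= z ->
  Phi (z - x) <= Phi (y - x) + Phi (z - y).
Proof.
move=> oI sub Ix Iz xy yz.
have -> : z - x = (y - x) + (z - y) by lra.
apply: sub; rewrite ?subr_ge0 //.
have -> : (y - x) + (z - y) = z - x by lra.
exact: ltB_ilength.
Qed.

Lemma nondecreasing_errorB (R : realType) (I : set R) (Phi : R -> R)
    (x y x' y' : R) :
  open I -> nondecreasing_on (error_dom I) Phi -> I x -> I y -> I x' -> I y' ->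
  x <= x' -> x' <= y' -> y' <= y -> Phi (y' - x') <= Phi (y - x).
Proof.
move=> oI mono Ix Iy Ix' Iy' xx' xy' yy'.
apply: mono; last by rewrite lerB.
  by rewrite inE; apply: error_domB.
by rewrite inE; apply: error_domB => //; lra.
Qed.

(** * Interpolations built from a nondecreasing function *)

Lemma interpolation_below_lower_ext (R : realType) (I : set R)
    (Phi f h : R -> R) (p : R) :
  open I -> error_function I Phi -> subadditive_error I Phi ->
  nondecreasing_on (error_dom I) Phi -> Phi_monotone I Phi f ->
  I p -> nondecreasing_on I h -> h p = f p ->
  (forall x, I x -> x <= p -> h x <= f x) ->
  interpolation_below I Phi f p (lower_ext Phi h p).
Proof.
move=> oI Phi0 sub mono fM Ip hM hp hf; split; rewrite /lower_ext ?lexx //.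
(* Left of [p], monotonicity of [h] and [0 <= Phi] suffice; across [p], [Phi (y - p) <= Phi (y - x)]
   as [Phi] is nondecreasing; right of [p], subadditivity bounds [Phi (y - p)] by
   [Phi (x - p) + Phi (y - x)]. The case [y <= p < x] is void. *)
- move=> x y Ix Iy xy; case: (leP x p) => xp; case: (leP y p) => yp.
  + have h_xy : h x <= h y by apply: hM; rewrite ?inE.
    have := Phi0 _ (error_domB oI Ix Iy xy); lra.
  + have h_xp : h x <= h p by apply: hM; rewrite ?inE.
    have := nondecreasing_errorB oI mono Ix Iy Ip Iy xp (ltW yp) (lexx y); lra.
  + lra.
  + have := subadditive_errorB oI sub Ip Iy (ltW xp) xy; lra.
- move=> x Ix; case: (leP x p) => xp; first exact: hf.
  have := fM p x Ip Ix (ltW xp); lra.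
Qed.

Lemma interpolation_above_upper_ext (R : realType) (I : set R)
    (Phi f h : R -> R) (p : R) :
  open I -> error_function I Phi -> subadditive_error I Phi ->
  nondecreasing_on (error_dom I) Phi -> Phi_monotone I Phi f ->
  I p -> nondecreasing_on I h -> h p = f p ->
  (forall x, I x -> p <= x -> f x <= h x) ->
  interpolation_above I Phi f p (upper_ext Phi h p).
Proof.
move=> oI Phi0 sub mono fM Ip hM hp hf; split; rewrite /upper_ext ?ltxx //.
(* Mirror image: subadditivity now serves the pairs left of [p], and monotonicity of [h] those right
   of it. *)
- move=> x y Ix Iy xy; case: (ltP x p) => xp; case: (ltP y p) => yp.
  + have := subadditive_errorB oI sub Ix Ip xy (ltW yp); lra.
  + have h_py : h p <= h y by apply: hM; rewrite ?inE.
    have := nondecreasing_errorB oI mono Ix Iy Ix Ip (lexx x) (ltW xp) yp; lra.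
  + lra.
  + have h_xy : h x <= h y by apply: hM; rewrite ?inE.
    have := Phi0 _ (error_domB oI Ix Iy xy); lra.
- move=> x Ix; case: (ltP x p) => xp; last exact: hf.
  have := fM x p Ix Ip (ltW xp); lra.
Qed.

(** * From interpolations back to [Phi]-monotonicity *)

Lemma lower_ext_Phi_monotone (R : realType) (I : set R) (Phi f : R -> R) :
  open I -> error_function I Phi ->
  (forall p, I p -> exists h : R -> R,
     interpolation_below I Phi f p (lower_ext Phi h p)) ->
  Phi_monotone I Phi f.
Proof.
move=> oI Phi0 fI x y Ix Iy xy; have [h [_ hx hf]] := fI x Ix.
have Phi_xy := Phi0 _ (error_domB oI Ix Iy xy).
have := hf y Iy; move: hx; rewrite /lower_ext lexx.
(* Beyond the base point [x] the bound by [f y] is the claim itself. The tie [y = x] falls in the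
   branch of [h], where only [0 <= Phi (y - x)] is left to use. *)
case: (leP y x) => [yx|]; last lra.
have xEy : x = y by apply/le_anti/andP.
by move: Phi_xy; rewrite -xEy; lra.
Qed.

(** Here the base point is the right endpoint [y], so that [x] lies on the half where [upper_ext]
    involves [Phi]. *)
Lemma upper_ext_Phi_monotone (R : realType) (I : set R) (Phi f : R -> R) :
  open I -> error_function I Phi ->
  (forall p, I p -> exists h : R -> R,
     interpolation_above I Phi f p (upper_ext Phi h p)) ->
  Phi_monotone I Phi f.
Proof.
move=> oI Phi0 fI x y Ix Iy xy; have [h [_ hy hf]] := fI y Iy.
have Phi_xy := Phi0 _ (error_domB oI Ix Iy xy).
have := hf x Ix; move: hy; rewrite /upper_ext ltxx.
case: (ltP x y) => [|yx]; first lra.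
have xEy : x = y by apply/le_anti/andP.
by move: Phi_xy; rewrite -xEy; lra.
Qed.

(** * Bounds on compact subintervals and the envelope of [f] *)

Lemma Phi_monotone_bounded (R : realType) (I : set R) (Phi f : R -> R)
    (x y t : R) :
  open I -> is_interval I -> nondecreasing_on (error_dom I) Phi ->
  Phi_monotone I Phi f -> I x -> I y -> x <= t -> t <= y ->
  f x - Phi (y - x) <= f t <= f y + Phi (y - x).
Proof.
move=> oI iI mono fM Ix Iy xt ty.
have It : I t by apply: (iI x y) => //; rewrite xt.
(* Compare [t] with both endpoints, then enlarge [Phi (t - x)] and [Phi (y - t)] to [Phi (y - x)],
   which does not depend on [t]. *)
have := fM x t Ix It xt; have := fM t y It Iy ty.
have := nondecreasing_errorB oI mono Ix Iy Ix It (lexx x) xt ty.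
have := nondecreasing_errorB oI mono Ix Iy It Iy xt ty (lexx y).
by move=> *; apply/andP; split; lra.
Qed.

(** The real [inf] takes the default value 0 on empty or unbounded sets; this guarantees that the
    infimum in [envelope] is a genuine one. *)
Lemma Phi_monotone_has_inf (R : realType) (I : set R) (Phi f : R -> R)
    (x y : R) :
  open I -> is_interval I -> nondecreasing_on (error_dom I) Phi ->
  Phi_monotone I Phi f -> I x -> I y -> x <= y -> has_inf (f @` `[x, y]).
Proof.
move=> oI iI mono fM Ix Iy xy; split.
  by exists (f x), x => //=; rewrite in_itv /= lexx.
exists (f x - Phi (y - x)) => _ [t /= + <-]; rewrite in_itv /= => /andP[xt ty].
by have /andP[] := Phi_monotone_bounded oI iI mono fM Ix Iy xt ty.
Qed.

Lemma Phi_monotone_has_sup (R : realType) (I : set R) (Phi f : R -> R)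
    (x y : R) :
  open I -> is_interval I -> nondecreasing_on (error_dom I) Phi ->
  Phi_monotone I Phi f -> I x -> I y -> x <= y -> has_sup (f @` `[x, y]).
Proof.
move=> oI iI mono fM Ix Iy xy; split.
  by exists (f x), x => //=; rewrite in_itv /= lexx.
exists (f y + Phi (y - x)) => _ [t /= + <-]; rewrite in_itv /= => /andP[xt ty].
by have /andP[] := Phi_monotone_bounded oI iI mono fM Ix Iy xt ty.
Qed.

(** This is the witness [H] of (ii), with the base point as second argument. On the diagonal both
    branches would give [f p]. *)
Definition envelope (R : realType) (f : R -> R) (x p : R) : R :=
  if x <= p then inf (f @` `[x, p]) else sup (f @` `[p, x]).

Lemma envelopexx (R : realType) (f : R -> R) (p : R) : envelope f p p = f p.
Proof. by rewrite /envelope lexx set_itv1 image_set1 inf1. Qed.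

Lemma envelope_le (R : realType) (f : R -> R) (x p : R) :
  x <= p -> envelope f x p = inf (f @` `[x, p]).
Proof. by rewrite /envelope => ->. Qed.

Lemma envelope_ge (R : realType) (f : R -> R) (x p : R) :
  p <= x -> envelope f x p = sup (f @` `[p, x]).
Proof.
move=> px; rewrite /envelope; case: (leP x p) => // xp.
have -> : x = p by apply/le_anti/andP.
by rewrite set_itv1 image_set1 inf1 sup1.
Qed.

Lemma envelope_min (R : realType) (I : set R) (Phi f : R -> R) (x y z : R) :
  open I -> is_interval I -> nondecreasing_on (error_dom I) Phi ->
  Phi_monotone I Phi f -> I x -> I y -> I z -> x <= y -> y <= z ->
  Num.min (envelope f x y) (envelope f y z) = envelope f x z.
Proof.
move=> oI iI mono fM Ix Iy Iz xy yz.
rewrite !envelope_le ?(le_trans xy yz) // (itvcc_setU xy yz) image_setU.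
by rewrite inf_setU_min //; apply: Phi_monotone_has_inf fM _ _ _.
Qed.

Lemma envelope_max (R : realType) (I : set R) (Phi f : R -> R) (x y z : R) :
  open I -> is_interval I -> nondecreasing_on (error_dom I) Phi ->
  Phi_monotone I Phi f -> I x -> I y -> I z -> x <= y -> y <= z ->
  Num.max (envelope f z y) (envelope f y x) = envelope f z x.
Proof.
move=> oI iI mono fM Ix Iy Iz xy yz.
rewrite !envelope_ge ?(le_trans xy yz) // (itvcc_setU xy yz) image_setU maxC.
by rewrite sup_setU_max //; apply: Phi_monotone_has_sup fM _ _ _.
Qed.

(** Two choices of [t] matter: [t = x] puts the envelope below [f] left of [p], and [t = p] compares
    it with [f p]. *)
Lemma envelope_le_fun (R : realType) (I : set R) (Phi f : R -> R) (x t p : R) :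
  open I -> is_interval I -> nondecreasing_on (error_dom I) Phi ->
  Phi_monotone I Phi f -> I x -> I p -> x <= t -> t <= p ->
  envelope f x p <= f t.
Proof.
move=> oI iI mono fM Ix Ip xt tp; have xp := le_trans xt tp.
rewrite envelope_le //; apply: ge_inf.
  by have [] := Phi_monotone_has_inf oI iI mono fM Ix Ip xp.
by exists t => //=; rewrite in_itv /= xt.
Qed.

Lemma envelope_ge_fun (R : realType) (I : set R) (Phi f : R -> R) (x t p : R) :
  open I -> is_interval I -> nondecreasing_on (error_dom I) Phi ->
  Phi_monotone I Phi f -> I x -> I p -> p <= t -> t <= x ->
  f t <= envelope f x p.
Proof.
move=> oI iI mono fM Ix Ip pt tx; have px := le_trans pt tx.
rewrite envelope_ge //; apply: ub_le_sup.
  by have [] := Phi_monotone_has_sup oI iI mono fM Ip Ix px.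
by exists t => //=; rewrite in_itv /= pt.
Qed.

(** If [x] and [y] lie on the same side of [p], the min or max identity exhibits one value as a
    minimum or maximum involving the other; if [p] lies between them, [f p] separates the two
    values. *)
Lemma envelope_nondecreasing (R : realType) (I : set R) (Phi f : R -> R)
    (p : R) :
  open I -> is_interval I -> nondecreasing_on (error_dom I) Phi ->
  Phi_monotone I Phi f -> I p -> nondecreasing_on I (fun x => envelope f x p).
Proof.
move=> oI iI mono fM Ip x y; rewrite !inE => Ix Iy xy.
case: (leP y p) => yp.
  by rewrite -(envelope_min oI iI mono fM Ix Iy Ip xy yp) ge_min lexx orbT.
case: (leP x p) => xp; last first.
  by rewrite -(envelope_max oI iI mono fM Ip Ix Iy (ltW xp) xy) le_max lexx orbT.
apply: (@le_trans _ _ (f p)).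
  exact: (envelope_le_fun oI iI mono fM).
exact: (envelope_ge_fun oI iI mono fM _ _ _ (ltW yp)).
Qed.

(** * The cycle of implications *)

Theorem theorem2p3 (R : realType) (I : set R) (hI : open_interval I)
    (Phi : R -> R) (hPhi : error_function I Phi)
    (hsub : subadditive_error I Phi)
    (hmono : nondecreasing_on (error_dom I) Phi)
    (f : R -> R) :
  [<-> (* (i) *)
       Phi_monotone I Phi f;
       (* (ii) *)
       exists H : R -> R -> R,
         (forall x y z, I x -> I y -> I z -> x <= y -> y <= z ->
            Num.min (H x y) (H y z) = H x z /\
            Num.max (H z y) (H y x) = H z x) /\
         (forall p, I p ->
            [/\ nondecreasing_on I (fun x => H x p),
                interpolation_below I Phi f p
                  (lower_ext Phi (fun x => H x p) p)
              & interpolation_above I Phi f p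
                  (upper_ext Phi (fun x => H x p) p)]);
       (* (iii) *)
       forall p, I p -> exists h : R -> R,
         nondecreasing_on I h /\
         interpolation_below I Phi f p (lower_ext Phi h p);
       (* (iv) *)
       forall p, I p -> exists h : R -> R,
         nondecreasing_on I h /\
         interpolation_above I Phi f p (upper_ext Phi h p)].
Proof.
have [_ oI iI] := hI.
have iii_i : (forall p, I p -> exists h : R -> R, nondecreasing_on I h /\
    interpolation_below I Phi f p (lower_ext Phi h p)) -> Phi_monotone I Phi f.
  move=> iii; apply: lower_ext_Phi_monotone => // p /iii[h [_ ?]]; by exists h.
have i_ii : Phi_monotone I Phi f ->
    forall p, I p -> [/\ nondecreasing_on I (fun x => envelope f x p),
      interpolation_below I Phi f p (lower_ext Phi (fun x => envelope f x p) p)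
    & interpolation_above I Phi f p (upper_ext Phi (fun x => envelope f x p) p)].
  move=> fM p Ip; have eM := envelope_nondecreasing oI iI hmono fM Ip; split=> //.
    apply: interpolation_below_lower_ext => //; first exact: envelopexx.
    by move=> x Ix xp; apply: (envelope_le_fun oI iI hmono fM).
  apply: interpolation_above_upper_ext => //; first exact: envelopexx.
  by move=> x Ix px; apply: (envelope_ge_fun oI iI hmono fM).
tfae.
- move=> fM; exists (envelope f); split; last exact: i_ii.
  move=> x y z Ix Iy Iz xy yz; split.
    exact: (envelope_min oI iI hmono fM).
  exact: (envelope_max oI iI hmono fM).
- by move=> [H [_ HI]] p /HI[HM HB _]; exists (fun x => H x p).
(* The function given by (iii) is discarded: (iii) yields (i), and the envelope then provides the
   interpolation from above. *)
- by move=> /iii_i /i_ii ii p /ii[eM _ eA]; exists (fun x => envelope f x p).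
- by move=> iv; apply: upper_ext_Phi_monotone => // p /iv[h [_ ?]]; exists h.
Qed.
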